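(* Let $\theta\in[\tfrac12,1]$, $\epsilon>0$, $\beta>0$, $\lambda_1,\lambda_2,\lambda_3>0$. Let $(\phi^n)$ (functions on $\Omega$) and $(u^n)$ (real numbers) be a solution of the $\mathcal V_W$-method on the (possibly nonuniform) mesh $0=t_0<\dots<t_N=T$, i.e. for every $1\le n\le N-1$, $$\tilde D_\tau^{\theta}\phi^{n+\theta}=\nabla\cdot\big(M^{*,n+\theta}\nabla\mu^{n+\theta}\big),$$ $$\mu^{n+\theta}=\frac{u^{n+1}}{\sqrt{\widetilde E_2^{n}}}V(\xi^{n+1})\mathcal Z^{*,n+\theta}+\frac{\lambda_1}{\epsilon^2}\phi^{n+\theta}-\lambda_2\Delta\phi^{n+\theta}+\lambda_3\Delta^2\phi^{n+\theta},$$ $$\frac{u^{n+1}-u^n}{\tau_{n+1}}=\frac{V(\xi^{n+1})}{2\sqrt{\widetilde E_2^{n}}}\int_\Omega\mathcal Z^{*,n+\theta}\,\frac{\phi^{n+1}-\phi^n}{\tau_{n+1}}\,d\Omega,\qquad \xi^{n+1}=\frac{u^{n+1}}{\sqrt{\widetilde E_2^{n}}},$$ with starting values satisfying $\int_\Omega\phi^1d\Omega=\int_\Omega\phi^0d\Omega$. Then the scheme conserves mass: $$\int_\Omega\phi^{n+1}d\Omega=\int_\Omega\phi^{n}d\Omega=\cdots=\int_\Omega\phi^{0}d\Omega\qquad\text{for all } 0\le n\le N-1.$$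
   Context: $\Omega\subset\mathbb R^d$ ($d=2,3$) is a bounded domain; all functions satisfy periodic boundary conditions (so integration by parts produces no boundary terms) and are sufficiently regular that all expressions below are well defined. Time mesh: $0=t_0<t_1<\cdots<t_N=T$, $\tau_n=t_n-t_{n-1}$, $\gamma_{n+1}=\tau_{n+1}/\tau_n$. For a sequence $(w^n)$, $$\tilde D_\tau^\theta w^{n+\theta}=\frac{1+2\theta\gamma_{n+1}}{\tau_{n+1}(1+\gamma_{n+1})}(w^{n+1}-w^n)+\frac{(1-2\theta)\gamma_{n+1}^2}{\tau_{n+1}(1+\gamma_{n+1})}(w^n-w^{n-1}),$$ $\phi^{n+\theta}=\theta\phi^{n+1}+(1-\theta)\phi^n$, $\phi^{*,n+\theta}=(1+\theta\gamma_{n+1})\phi^n-\theta\gamma_{n+1}\phi^{n-1}$. Anisotropic quantities: $\mathbf n=\nabla\phi/|\nabla\phi|$, $\gamma(\mathbf n)=1+\alpha\big(4\sum_{i=1}^d n_i^4-3\big)$ with $\alpha\ge0$ (not to be confused with the step ratios $\gamma_n$), $F(\phi)=\frac14(\phi^2-1)^2$, $f(\phi)=F'(\phi)=\phi(\phi^2-1)$, $f'(\phi)=3\phi^2-1$, $$\mathbf m=\gamma(\mathbf n)\nabla\phi+\frac{\mathbb P\nabla_{\mathbf n}\gamma(\mathbf n)}{|\nabla\phi|}\Big(\tfrac12|\nabla\phi|^2+\tfrac1{\epsilon^2}F(\phi)\Big),\qquad \mathbb P=\mathbb I-\mathbf n\mathbf n^T,$$ $$\mathcal Z(\phi)=\frac1{\epsilon^2}\gamma(\mathbf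 n)f(\phi)-\nabla\cdot\mathbf m+\beta\Big(\Delta-\frac1{\epsilon^2}f'(\phi)\Big)\Big(\Delta\phi-\frac1{\epsilon^2}f(\phi)\Big)-\frac{\lambda_1}{\epsilon^2}\phi+\lambda_2\Delta\phi-\lambda_3\Delta^2\phi,$$ $\mathcal Z^{*,n+\theta}=\mathcal Z(\phi^{*,n+\theta})$, $$\widetilde E_2(\phi)=\int_\Omega\Big(g(\phi)-\frac{\lambda_1}{2\epsilon^2}|\phi|^2-\frac{\lambda_2}2|\nabla\phi|^2-\frac{\lambda_3}2|\Delta\phi|^2\Big)d\Omega+C_0,\quad g(\phi)=\gamma(\mathbf n)\Big(\tfrac12|\nabla\phi|^2+\tfrac1{\epsilon^2}F(\phi)\Big)+\tfrac\beta2\Big(\Delta\phi-\tfrac1{\epsilon^2}f(\phi)\Big)^2,$$ $\widetilde E_2^n=\widetilde E_2(\phi^n)$, where the constant $C_0>0$ is chosen so that $\widetilde E_2>0$. The mobility $M(\phi)\ge M_0>0$ is a function of $\phi$ or a constant, and $M^{*,n+\theta}=M(\phi^{*,n+\theta})$. $V\in C^2(\mathbb R)$ is a positive real function with $V(1)=1$ and $\lim_{\xi\to1}\frac{V(\xi)-1}{1-\xi}=1$. *)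

(* Defs.v *)
From HB Require Import structures.
From mathcomp Require Import all_boot all_order all_algebra.
From mathcomp Require Import all_classical all_reals all_analysis.

Set Implicit Arguments.
Unset Strict Implicit.
Unset Printing Implicit Defensive.

Import Order.TTheory GRing.Theory Num.Theory.
Import numFieldNormedType.Exports.

Local Open Scope classical_set_scope.
Local Open Scope ring_scope.

(* Lebesgue measure on d-tuples of reals, by recursion on d: the product of the
   one-dimensional Lebesgue measure with the measure on (d-1)-tuples, transported
   along (x, s) |-> x :: s. *)
Section lebesgue_tuple_step.
Context (R : realType) (d : nat).
Local Notation RR := (measurableTypeR R).

Definition cons_pair (p : RR * d.-tuple RR) : d.+1.-tuple RR :=
  [the d.+1.-tuple RR of p.1 :: p.2].

Lemma measurable_cons_pair : measurable_fun [set: (RR * d.-tuple RR)%type] cons_pair.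
Proof. by apply: measurable_cons; [exact: measurable_fst|exact: measurable_snd]. Qed.

Variable mu : {sigma_finite_measure set (d.-tuple RR) -> \bar R}.

Definition lebesgue_cons : set (d.+1.-tuple RR) -> \bar R :=
  pushforward (lebesgue_measure \x mu)%E cons_pair.

Let m : {measure set (d.+1.-tuple RR) -> \bar R} :=
  measure_function_pushforward__canonical__measure_function_Measure
   (lebesgue_measure \x mu)%E measurable_cons_pair.

HB.instance Definition _ := Measure.copy lebesgue_cons m.

Let lebesgue_cons_sigma_finite : sigma_finite setT lebesgue_cons.
Proof.
pose leb : {sigma_finite_measure set RR -> \bar R} := lebesgue_measure.
have /sigma_finiteP[F [TF ndF Foo]] := sigma_finiteT leb.
have /sigma_finiteP[G [TG ndG Goo]] := sigma_finiteT mu.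
pose tl (s : d.+1.-tuple RR) : d.-tuple RR := [tuple of behead s].
exists (fun n => (@tnth _ RR ^~ ord0) @^-1` F n `&` tl @^-1` G n) => [|n].
  apply/seteqP; split => // s _.
  have [i _ Fi] : (\bigcup_i F i) (tnth s ord0) by rewrite -TF.
  have [j _ Gj] : (\bigcup_i G i) (tl s) by rewrite -TG.
  exists (maxn i j) => //; split => /=.
    by move: (tnth s ord0) Fi; exact/subsetPset/ndF/leq_maxl.
  by move: (tl s) Gj; exact/subsetPset/ndG/leq_maxr.
have [mF Fn] := Foo n; have [mG Gn] := Goo n; split.
  apply: measurableI; rewrite -[X in measurable X]setTI.
    exact: measurable_tnth.
  exact: measurable_behead.
rewrite /lebesgue_cons /pushforward (_ : cons_pair @^-1` _ = F n `*` G n).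
  by rewrite product_measure1E// lte_mul_pinfty// ge0_fin_numE.
apply/seteqP; split => -[x s] /= [Fx Gs]; split => //.
  by move: Gs; congr (G n _); apply: val_inj.
by move: Gs; congr (G n _); apply: val_inj.
Qed.

HB.instance Definition _ := Measure_isSigmaFinite.Build _ _ _
  lebesgue_cons lebesgue_cons_sigma_finite.

End lebesgue_tuple_step.

Fixpoint lebesgue_tuple (R : realType) (d : nat) :
    {sigma_finite_measure set (d.-tuple (measurableTypeR R)) -> \bar R} :=
  match d with
  | 0 => \d_([tuple] : 0.-tuple (measurableTypeR R))
  | d'.+1 => lebesgue_cons (lebesgue_tuple R d')
  end.

Lemma lebesgue_tupleE (R : realType) (d : nat)
    (A : 'I_d -> set (measurableTypeR R)) :
  (forall i, measurable (A i)) ->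
  lebesgue_tuple R d [set s | forall i, A i (tnth s i)] =
  (\prod_(i < d) (@lebesgue_measure R) (A i))%E.
Proof.
elim: d A => [|d IH] A mA.
  by rewrite big_ord0 /= diracE mem_set// => -[].
rewrite big_ord_recl /= /lebesgue_cons /pushforward.
set B := [set s : d.-tuple (measurableTypeR R) | forall i, A (lift ord0 i) (tnth s i)].
have -> : cons_pair (R := R) (d := d) @^-1` [set s | forall i, A i (tnth s i)] = A ord0 `*` B.
  apply/seteqP; split => [[x s] /= h|[x s] /= [h0 h] i].
    split; first by have := h ord0.
    by move=> i /=; have := h (lift ord0 i); rewrite tnthS.
  by case: (unliftP ord0 i) => [j|] ->; rewrite ?tnthS.
have mB : measurable B.
  rewrite (_ : B = \bigcap_(i in [set: 'I_d])
      ((fun s : d.-tuple (measurableTypeR R) => tnth s i) @^-1` A (lift ord0 i))); last first.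
    by apply/seteqP; split => s /= h i; [move=> _; exact: h|exact: h].
  apply: fin_bigcap_measurable => [|i _]; first exact: finite_finset.
  rewrite -[X in measurable X]setTI.
  by apply: (@measurable_tnth _ _ _ i) => //; exact: mA.
rewrite product_measure1E//=.
by rewrite -IH.
Qed.

Section vector_calculus.
Context (R : realType) (d : nat).
Implicit Types (a b x n : 'rV[R]_d) (f : 'rV[R]_d -> R) (v : 'rV[R]_d -> 'rV[R]_d).

Definition row_of_tuple (s : d.-tuple (measurableTypeR R)) : 'rV[R]_d :=
  \row_i tnth s i.

Definition box a b : set 'rV[R]_d := [set x | forall i, a 0 i < x 0 i < b 0 i].

Definition integral_box a b f : R :=
  \int[lebesgue_tuple R d]_(s in row_of_tuple @^-1` box a b) f (row_of_tuple s).

Definition box_periodic a b f : Prop :=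
  forall i, periodic f ((b 0 i - a 0 i) *: delta_mx 0 i).

Definition partial (i : 'I_d) f x : R := 'D_(delta_mx 0 i) f x.

Definition grad f x : 'rV[R]_d := \row_i partial i f x.

Definition divergence v x : R := \sum_(i < d) partial i (fun y => v y 0 i) x.

Definition laplacian f : 'rV[R]_d -> R := divergence (grad f).

(* The library norm `|x| on row vectors is the sup norm. *)
Definition enorm x : R := Num.sqrt (\sum_(i < d) x 0 i ^+ 2).

End vector_calculus.

(* On a finite-dimensional space this is the usual class C^k: all iterated
   directional derivatives up to order k exist and are continuous. *)
Fixpoint Ck (R : realType) (U : normedModType R) (k : nat) (f : U -> R) : Prop :=
  continuous f /\
  match k with
  | 0 => True
  | k'.+1 => forall v, (forall x, derivable f x v) /\ Ck k' (fun x => 'D_v f x)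
  end.

Section phase_field.
Context (R : realType) (d : nat) (alpha beta eps lambda1 lambda2 lambda3 : R).
Implicit Types (n x : 'rV[R]_d) (phi : 'rV[R]_d -> R).

Definition well (s : R) : R := (s ^+ 2 - 1) ^+ 2 / 4.
Definition well1 (s : R) : R := s * (s ^+ 2 - 1).
Definition well2 (s : R) : R := 3 * s ^+ 2 - 1.

(* Division is total: normal phi x = 0 where grad phi x = 0. *)
Definition normal phi x : 'rV[R]_d := (enorm (grad phi x))^-1 *: grad phi x.

Definition anisotropy n : R := 1 + alpha * (4 * (\sum_(i < d) n 0 i ^+ 4) - 3).

(* Vectors are rows, so the matrix n n^T of the column convention is n^T *m n. *)
Definition tangent_proj n : 'M[R]_d := 1%:M - n^T *m n.

Definition density phi x : R :=
  enorm (grad phi x) ^+ 2 / 2 + well (phi x) / eps ^+ 2.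

Definition m_vec phi x : 'rV[R]_d :=
  anisotropy (normal phi x) *: grad phi x
  + (density phi x / enorm (grad phi x))
      *: (grad anisotropy (normal phi x) *m tangent_proj (normal phi x)).

Definition calZ phi x : R :=
  let w y := laplacian phi y - well1 (phi y) / eps ^+ 2 in
  anisotropy (normal phi x) * well1 (phi x) / eps ^+ 2
  - divergence (m_vec phi) x
  + beta * (laplacian w x - well2 (phi x) / eps ^+ 2 * w x)
  - lambda1 / eps ^+ 2 * phi x
  + lambda2 * laplacian phi x
  - lambda3 * laplacian (laplacian phi) x.

(* The points where calZ phi makes sense: the normal does not exist at a critical
   point of phi, but for alpha = 0 the anisotropy is identically 1 and the normal
   drops out of calZ. A periodic C^1 function always has critical points. *)
Definition calZ_defined phi x : Prop := alpha = 0 \/ grad phi x <> 0.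

Definition energy_g phi x : R :=
  anisotropy (normal phi x) * density phi x
  + beta / 2 * (laplacian phi x - well1 (phi x) / eps ^+ 2) ^+ 2.

Definition E2 (a b : 'rV[R]_d) (C0 : R) phi : R :=
  integral_box a b (fun x =>
    energy_g phi x - lambda1 / (2 * eps ^+ 2) * phi x ^+ 2
    - lambda2 / 2 * enorm (grad phi x) ^+ 2
    - lambda3 / 2 * laplacian phi x ^+ 2) + C0.

End phase_field.

Section time_discretization.
Context (R : realType) (t : nat -> R) (theta : R).
Implicit Types (w : nat -> R) (n : nat).

Definition step n : R := t n - t n.-1.
Definition ratio n : R := step n / step n.-1.

Definition Dtheta w n : R :=
  (1 + 2 * theta * ratio n.+1) / (step n.+1 * (1 + ratio n.+1)) * (w n.+1 - w n)
  + (1 - 2 * theta) * ratio n.+1 ^+ 2 / (step n.+1 * (1 + ratio n.+1))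
      * (w n - w n.-1).

Definition average w n : R := theta * w n.+1 + (1 - theta) * w n.

Definition extrapolate w n : R :=
  (1 + theta * ratio n.+1) * w n - theta * ratio n.+1 * w n.-1.

End time_discretization.

(* Main.v *)
(* Integrating the discrete evolution equation over the periodic cell kills the
   right-hand side: the flux M grad mu is a periodic C^1 field, so by Fubini and the
   fundamental theorem of calculus along each coordinate its divergence has mean
   zero. What remains is c1 (m_{n+1} - m_n) + c2 (m_n - m_{n-1}) = 0 for the masses
   m_n, with c1 > 0; since m_1 = m_0, all masses agree by induction. *)
Require Import Defs.
From HB Require Import structures.
From mathcomp Require Import all_boot all_order all_algebra.
From mathcomp Require Import all_classical all_reals all_analysis.
From mathcomp Require Import measurable_realfun.

Set Implicit Arguments.
Unset Strict Implicit.
Unset Printing Implicit Defensive.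

Import Order.TTheory GRing.Theory Num.Theory.
Import numFieldNormedType.Exports.

Local Open Scope classical_set_scope.
Local Open Scope ring_scope.

(** * Measurability and boundedness on boxes *)

Lemma measurable_tuple_box (R : realType) (d : nat)
    (A : 'I_d -> set (measurableTypeR R)) : (forall i, measurable (A i)) ->
  measurable [set s : d.-tuple (measurableTypeR R) | forall i, A i (tnth s i)].
Proof.
move=> mA; rewrite (_ : [set s | _] = \bigcap_(i in [set: 'I_d])
    ((fun s : d.-tuple (measurableTypeR R) => tnth s i) @^-1` A i)); last first.
  by apply/seteqP; split => s /= h i; [move=> _; exact: h|exact: h].
apply: fin_bigcap_measurable => [|i _]; first exact: finite_finset.
by rewrite -[X in measurable X]setTI; apply: measurable_tnth.
Qed.

Lemma lebesgue_tuple_box_lty (R : realType) (d : nat)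
    (A : 'I_d -> set (measurableTypeR R)) : (forall i, measurable (A i)) ->
  (forall i, (@lebesgue_measure R (A i) < +oo)%E) ->
  (lebesgue_tuple R d [set s | forall i, A i (tnth s i)] < +oo)%E.
Proof.
move=> mA finA; rewrite lebesgue_tupleE// -ge0_fin_numE; last exact: prode_ge0.
by apply: (big_ind (fun x => x \is a fin_num)) => // [x y|j _];
  [exact: fin_numM|rewrite ge0_fin_numE].
Qed.

Lemma preimage_box (R : realType) (d : nat) (a b : 'rV[R]_d) :
  @row_of_tuple R d @^-1` box a b =
  [set s | forall i, `]a 0 i, b 0 i[%classic (tnth s i)].
Proof.
by apply/seteqP; split => s /= h i; have := h i; rewrite mxE /= in_itv.
Qed.

Lemma measurable_preimage_box (R : realType) (d : nat) (a b : 'rV[R]_d) :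
  measurable (@row_of_tuple R d @^-1` box a b).
Proof.
rewrite preimage_box.
apply: (@measurable_tuple_box R d (fun i => `]a 0 i, b 0 i[%classic)) => i.
exact: measurable_itv. Qed.

(** Balls of the sup norm are cubes, so choosing a rational number on each side of every coordinate
    of a point gives a box around it that still lies in [U]. Indexing by pairs of rational rows is
    what makes the union countable. *)
Lemma open_bigcup_rat_box (R : realType) (d : nat) (U : set 'rV[R]_d) : open U ->
  U = \bigcup_(pq in [set pq : 'rV[rat]_d * 'rV[rat]_d |
        box (map_mx ratr pq.1) (map_mx ratr pq.2) `<=` U])
      box (map_mx ratr pq.1) (map_mx ratr pq.2).
Proof.
move=> oU; apply/seteqP; split => [x Ux|x [pq /= sU]]; last exact: sU.
have /nbhs_ballP[e /= e0 xeU] : nbhs x U by exact: open_nbhs_nbhs.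
have lo i : exists q, x 0 i - e < ratr q < x 0 i.
  have /rat_in_itvoo[q] : x 0 i - e < x 0 i by rewrite ltrBlDr ltrDl.
  by rewrite in_itv /=; exists q.
have hi i : exists q, x 0 i < ratr q < x 0 i + e.
  have /rat_in_itvoo[q] : x 0 i < x 0 i + e by rewrite ltrDl.
  by rewrite in_itv /=; exists q.
have [p hp] := choice lo; have [q hq] := choice hi.
exists (\row_i p i, \row_i q i) => [/= y yb|i] /=; last first.
  by rewrite !mxE; have /andP[_ ->] := hp i; have /andP[-> _] := hq i.
apply: xeU; split=> // i j; rewrite ord1.
have := yb j; rewrite !mxE /ball /= => /andP[py yq].
have /andP[pj1 pj2] := hp j; have /andP[qj1 qj2] := hq j.
rewrite ltr_distlC.
by rewrite (lt_trans pj1 py) (lt_trans yq qj2).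
Qed.

(* Tuples carry the product sigma-algebra, so preimages of open sets are measurable
   only because open sets are countable unions of rational boxes. *)
Lemma measurable_fun_row_of_tuple (R : realType) (d : nat) (f : 'rV[R]_d -> R) :
  continuous f ->
  measurable_fun [set: d.-tuple (measurableTypeR R)] (f \o @row_of_tuple R d).
Proof.
move=> cf mD; apply: (measurability _ (RGenOInfty.measurableE R)) => //.
move=> /= _ [_ [y ->] <-]; rewrite setTI preimage_itvoy.
have oU : open [set x | y < f x].
  by move/continuousP: cf => /(_ _ (@open_gt R y)).
rewrite (_ : [set _ | _] = @row_of_tuple R d @^-1` [set x | y < f x])//.
rewrite (open_bigcup_rat_box oU) preimage_bigcup.
rewrite bigcup_mkcond; apply: countable_bigcupT_measurable => [|pq]; first exact: countableP.
by case: ifPn => // _; exact: measurable_preimage_box.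
Qed.

(** The open box lies in a product of segments, which is compact. *)
Lemma continuous_bounded_box (R : realType) (d : nat) (a b : 'rV[R]_d)
    (f : 'rV[R]_d -> R) : continuous f ->
  exists C, forall x, box a b x -> `|f x| <= C.
Proof.
move=> cf.
pose K := [set v : 'rV[R]_d | forall i, `[a 0 i, b 0 i]%classic (v ord0 i)].
have cK : compact K.
  apply: (@rV_compact _ _ (fun i => `[a 0 i, b 0 i]%classic)) => i.
  exact: segment_compact.
have cf' : {within K, continuous f} by exact: continuous_subspaceT.
have [C [_ hC]] := compact_bounded (continuous_compact cf' cK).
(* Boundedness is phrased as a bound by every real strictly above [C], hence the shift by 1. *)
exists (C + 1) => x xab; apply: (hC (C + 1)); first by rewrite ltrDl.
exists x => // i; have /andP[ax xb] := xab i.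
by rewrite /= in_itv /= !ltW.
Qed.

(** * Fubini on tuples along a chosen coordinate *)

Definition tuple_upd (T : Type) (d : nat) (s : d.-tuple T) (i : 'I_d) (y : T) :
    d.-tuple T :=
  [tuple if j == i then y else tnth s j | j < d].

Lemma tuple_upd_cons0 (T : Type) (d : nat) (x y : T) (s : d.-tuple T) :
  tuple_upd [tuple of x :: s] ord0 y = [tuple of y :: s].
Proof.
apply: eq_from_tnth => j; rewrite tnth_mktuple.
by case: (unliftP ord0 j) => [k|] ->; rewrite ?eqxx// !tnthS.
Qed.

Lemma tuple_upd_consS (T : Type) (d : nat) (x y : T) (s : d.-tuple T) (i : 'I_d) :
  tuple_upd [tuple of x :: s] (lift ord0 i) y = [tuple of x :: tuple_upd s i y].
Proof.
apply: eq_from_tnth => j; rewrite tnth_mktuple.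
case: (unliftP ord0 j) => [k|] ->; rewrite ?tnthS ?tnth0//.
by rewrite (inj_eq lift_inj) tnth_mktuple.
Qed.

(* Fubini's theorem, integrating in the i-th coordinate first. *)
Lemma lebesgue_tuple_integral_slice0 (R : realType) (d : nat)
    (A : 'I_d -> set (measurableTypeR R)) (f : d.-tuple (measurableTypeR R) -> R)
    (C : R) (i : 'I_d) :
  (forall j, measurable (A j)) ->
  (forall j, (@lebesgue_measure R (A j) < +oo)%E) ->
  measurable_fun [set: d.-tuple (measurableTypeR R)] f ->
  (forall s, (forall j, A j (tnth s j)) -> `|f s| <= C) ->
  (forall s : d.-tuple (measurableTypeR R),
     \int[@lebesgue_measure R]_(y in A i) (f (tuple_upd s i y))%:E = 0)%E ->
  (\int[lebesgue_tuple R d]_(s in [set s | forall j, A j (tnth s j)]) (f s)%:E = 0)%E.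
Proof.
elim: d A f i => [|d IH] A f i mA finA mf fC f0; first by case: (i).
pose B := [set s : d.-tuple (measurableTypeR R) | forall j, A (lift ord0 j) (tnth s j)].
have mB : measurable B by apply: (@measurable_tuple_box R d (fun j => A (lift ord0 j))).
have finB : (lebesgue_tuple R d B < +oo)%E.
  exact: (@lebesgue_tuple_box_lty R d (fun j => A (lift ord0 j))).
set D := [set s | _].
have mD : measurable D by exact: (@measurable_tuple_box R d.+1 A).
have preD : cons_pair (R := R) (d := d) @^-1` D = A ord0 `*` B.
  apply/seteqP; split => [[x s] /= h|[x s] /= [h0 h] j].
    split; first by have := h ord0.
    by move=> j /=; have := h (lift ord0 j); rewrite tnthS.
  by case: (unliftP ord0 j) => [k|] ->; rewrite ?tnthS.
(* Extension by zero turns the integral over the box into one over the whole space, where the change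
   of variables along [cons_pair] and Fubini apply. *)
pose g (p : measurableTypeR R * d.-tuple (measurableTypeR R)) : \bar R :=
  ((fun s => (f s)%:E) \_ D) (cons_pair p).
have gE p : g p = (((fun p => (f (cons_pair p))%:E) \_ (A ord0 `*` B)) p).
  by rewrite /g /patch -preD /=; congr (if _ then _ else _); rewrite !mem_setE.
pose h : d.+1.-tuple (measurableTypeR R) -> \bar R := (fun s => (f s)%:E) \_ D.
have mfD : measurable_fun [set: d.+1.-tuple (measurableTypeR R)] h.
  apply/(measurable_restrictT _ mD)/measurable_EFinP.
  exact: measurable_funTS.
have finAB : ((@lebesgue_measure R \x lebesgue_tuple R d) (A ord0 `*` B) < +oo)%E.
  rewrite product_measure1E//; apply: lte_mul_pinfty => //.
  by rewrite ge0_fin_numE//; exact: finA.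
have intg : (@lebesgue_measure R \x lebesgue_tuple R d)%E.-integrable setT g.
  rewrite (_ : g = (fun p => (f (cons_pair p))%:E) \_ (A ord0 `*` B)); last first.
    by apply/funext => p; exact: gE.
  apply/(integrable_mkcond _ (measurableX (mA ord0) mB)).
  apply: (@measurable_bounded_integrable _ _ _ _ (f \o @cons_pair R d)) => //.
  - exact: measurableX.
  - apply/measurable_funTS/measurableT_comp => //.
    exact: measurable_cons_pair.
  - exists C; split; first exact: num_real.
    move=> M CM p; rewrite -preD => Dp; apply: le_trans (ltW CM).
    exact: fC.
rewrite integral_mkcond.
rewrite [LHS](integral_pushforward (@measurable_cons_pair R d) mfD)//.
rewrite preimage_setT.
have gsec x s : g (x, s) =
   (((fun x => (((fun s => (f (cons_pair (x, s)))%:E) \_ B) s)) \_ (A ord0)) x).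
  rewrite gE /patch in_setX/=.
  by case: (x \in A ord0).
(* If [i] is a tail coordinate, the tail is integrated first and the induction hypothesis applies
   for each fixed head [x]. If [i] is the head, the head is integrated first and [f0] applies
   directly. *)
case: (unliftP ord0 i) f0 => [k|] -> f0.
- rewrite -[LHS](integral12_prod_meas1 intg) /fubini_F.
  apply: integral0_eq => x _.
  have [xA|xA] := pselect (A ord0 x); last first.
    apply: integral0_eq => s _; rewrite gE patchN// notin_setE => -[].
    by [].
  rewrite (eq_integral (fun s => ((fun s => (f (cons_pair (x, s)))%:E) \_ B) s)); last first.
    by move=> s _; rewrite gsec patchT// inE.
  rewrite -integral_mkcond.
  apply: (IH (fun j => A (lift ord0 j)) (fun s => f (cons_pair (x, s))) k) => //.
  + apply: measurableT_comp => //; apply: measurableT_comp => //.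
    exact: measurable_cons_pair.
  + move=> s Bs; apply: fC => j.
    by case: (unliftP ord0 j) => [l|] ->; rewrite ?tnthS.
  + move=> s; rewrite -[RHS](f0 [tuple of x :: s]).
    by apply: eq_integral => y _; rewrite tuple_upd_consS.
- rewrite -[LHS](integral21_prod_meas1 intg) /fubini_G.
  apply: integral0_eq => s _.
  have [sB|sB] := pselect (B s); last first.
    by apply: integral0_eq => x _; rewrite gE patchN// notin_setE => -[].
  rewrite (eq_integral (((fun x => (f (cons_pair (x, s)))%:E) \_ (A ord0)))); last first.
    move=> x _; rewrite gsec /patch; case: ifPn => // _.
    by rewrite mem_set.
  (* The head 0 is an arbitrary placeholder: [tuple_upd] overwrites it with the integration
     variable. *)
  rewrite -integral_mkcond -[RHS](f0 [tuple of 0 :: s]).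
  by apply: eq_integral => y _; rewrite tuple_upd_cons0.
Qed.

(** * Derivatives along lines and the fundamental theorem of calculus *)

(** Both difference quotients are the same function of [h]. This carries one-variable calculus over
    to directional derivatives. *)
Lemma derive_line (R : realType) (V : normedModType R) (f : V -> R) (x v : V) (t : R) :
  (derivable (fun s : R => f (s *: v + x)) t 1 <-> derivable f (t *: v + x) v) /\
  'D_1 (fun s : R => f (s *: v + x)) t = 'D_v f (t *: v + x).
Proof.
rewrite /derivable /derive.
set g1 := fun h => h^-1 *: _; set g2 := fun h => h^-1 *: _.
suff -> : g1 = g2 by [].
by apply/funext => h; rewrite /g1 /g2 /= [h *: 1]mulr1 scalerDl addrA.
Qed.

(** Puts a slice used in Fubini into the form of a line through a base point, as [derive_line]
    expects. *)
Lemma row_of_tuple_upd (R : realType) (d : nat) (s : d.-tuple (measurableTypeR R))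
    (i : 'I_d) (y : R) :
  row_of_tuple (tuple_upd s i y) =
  y *: delta_mx 0 i + row_of_tuple (tuple_upd s i (0 : R)).
Proof.
apply/rowP => j; rewrite !mxE !tnth_mktuple eqxx /=.
by case: eqP => _; rewrite ?mulr1 ?addr0 ?mulr0 ?add0r.
Qed.

Lemma integral_partial_periodic (R : realType) (F : R -> R) (a b : R) : a < b ->
  (forall y, derivable F y 1) -> continuous F^`()%classic -> F a = F b ->
  (\int[@lebesgue_measure R]_(y in `]a, b[) (F^`()%classic y)%:E = 0)%E.
Proof.
move=> ab dF cF' Fab.
have cF : continuous F.
  by move=> y; apply/differentiable_continuous/derivable1_diffP.
(* The fundamental theorem is stated on the closed interval; the two endpoints form a null set. *)
rewrite -(@integral_itv_bndoo R a b (fun y => (F^`()%classic y)%:E) true false); last first.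
  by apply/measurable_EFinP/measurable_funTS; exact: continuous_measurable_fun.
rewrite (@continuous_FTC2 R F^`()%classic F a b)//; first by rewrite Fab subee.
  exact: continuous_subspaceT.
split => //.
  by apply: cvg_at_right_filter; exact: cF.
by apply: cvg_at_left_filter; exact: cF.
Qed.

(** On each line parallel to the i-th axis the integrand is the derivative of the restriction of
    [g], whose values at the two ends differ by one period; hence every slice integrates to zero. *)
Lemma integral_box_partial (R : realType) (d : nat) (a b : 'rV[R]_d) (i : 'I_d)
    (g : 'rV[R]_d -> R) : a 0 i < b 0 i ->
  (forall x, derivable g x (delta_mx 0 i)) -> continuous (partial i g) ->
  periodic g ((b 0 i - a 0 i) *: delta_mx 0 i) ->
  integral_box a b (partial i g) = 0.
Proof.
move=> abi dg cg pg.
have [C hC] := continuous_bounded_box a b cg.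
rewrite /integral_box /Rintegral preimage_box.
rewrite (@lebesgue_tuple_integral_slice0 R d (fun j => `]a 0 j, b 0 j[%classic)
  (partial i g \o @row_of_tuple R d) C i)//.
- by move=> j; rewrite /= lebesgue_measure_itv /=; case: ifPn; rewrite ?ltry.
- exact: measurable_fun_row_of_tuple.
- move=> s hs; apply: hC => j; have := hs j.
  by rewrite /= in_itv /= mxE.
- move=> s; pose x := row_of_tuple (tuple_upd s i (0 : R)).
  pose F (y : R) := g (y *: delta_mx 0 i + x).
  have F'E : F^`()%classic = fun y => partial i g (y *: delta_mx 0 i + x).
    by apply/funext => y; rewrite derive1E (derive_line g x (delta_mx 0 i) y).2.
  rewrite -[RHS](@integral_partial_periodic R F (a 0 i) (b 0 i))//.
  + by apply: eq_integral => y _; rewrite F'E /= row_of_tuple_upd.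
  + by move=> y; apply/(derive_line g x (delta_mx 0 i) y).1.
  + rewrite F'E => y.
    apply: (@continuous_comp _ _ _ (fun y : R => y *: delta_mx 0 i + x)); last exact: cg.
    by apply: cvgD; [exact: scalel_continuous|exact: cvg_cst].
  + by rewrite /F -(pg (a 0 i *: _ + x)) addrAC -scalerDl subrKC.
Qed.

(** * Linearity of the box integral and the periodic divergence theorem *)

Lemma integrable_box (R : realType) (d : nat) (a b : 'rV[R]_d) (f : 'rV[R]_d -> R) :
  continuous f ->
  (lebesgue_tuple R d).-integrable (@row_of_tuple R d @^-1` box a b)
    (EFin \o (f \o @row_of_tuple R d)).
Proof.
move=> cf; have [C hC] := continuous_bounded_box a b cf.
have finB : (lebesgue_tuple R d (@row_of_tuple R d @^-1` box a b) < +oo)%E.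
  rewrite preimage_box.
  apply: (@lebesgue_tuple_box_lty R d (fun i => `]a 0 i, b 0 i[%classic)) => i.
    exact: measurable_itv.
  by rewrite lebesgue_measure_itv; case: ifPn; rewrite ?ltry.
apply: measurable_bounded_integrable => //.
- exact: measurable_preimage_box.
- by apply: measurable_funTS; exact: measurable_fun_row_of_tuple.
- exists C; split; first exact: num_real.
  by move=> M CM s /= bs; apply: le_trans (ltW CM); exact: hC.
Qed.

Lemma eq_integral_box (R : realType) (d : nat) (a b : 'rV[R]_d) (f g : 'rV[R]_d -> R) :
  (forall x, box a b x -> f x = g x) -> integral_box a b f = integral_box a b g.
Proof.
by move=> fg; apply: eq_Rintegral => s /set_mem; exact: fg.
Qed.

Lemma integral_boxD (R : realType) (d : nat) (a b : 'rV[R]_d) (f g : 'rV[R]_d -> R) :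
  continuous f -> continuous g ->
  integral_box a b (fun x => f x + g x) = integral_box a b f + integral_box a b g.
Proof.
move=> cf cg; apply: RintegralD; first exact: measurable_preimage_box.
- exact: integrable_box.
- exact: integrable_box.
Qed.

Lemma integral_boxZ (R : realType) (d : nat) (a b : 'rV[R]_d) (c : R) (f : 'rV[R]_d -> R) :
  continuous f -> integral_box a b (fun x => c * f x) = c * integral_box a b f.
Proof.
move=> cf; apply: RintegralZl; first exact: measurable_preimage_box.
exact: integrable_box.
Qed.

Lemma integral_boxB (R : realType) (d : nat) (a b : 'rV[R]_d) (f g : 'rV[R]_d -> R) :
  continuous f -> continuous g ->
  integral_box a b (fun x => f x - g x) = integral_box a b f - integral_box a b g.
Proof.
move=> cf cg; apply: RintegralB; first exact: measurable_preimage_box.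
- exact: integrable_box.
- exact: integrable_box.
Qed.

Lemma integral_box_divergence (R : realType) (d : nat) (a b : 'rV[R]_d)
    (v : 'rV[R]_d -> 'rV[R]_d) : (forall i, a 0 i < b 0 i) ->
  (forall i x, derivable (fun y => v y 0 i) x (delta_mx 0 i)) ->
  (forall i, continuous (partial i (fun y => v y 0 i))) ->
  (forall i, periodic v ((b 0 i - a 0 i) *: delta_mx 0 i)) ->
  integral_box a b (divergence v) = 0.
Proof.
move=> ab dv cv pv; rewrite /integral_box /Rintegral.
rewrite (eq_integral (fun s : d.-tuple (measurableTypeR R) =>
    (\sum_(i < d) (partial i (fun y => v y 0 i) (row_of_tuple s))%:E)%E)); last first.
  by move=> s _; rewrite sumEFin.
rewrite integral_sum; last 2 first.
  exact: measurable_preimage_box.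
  by move=> i; exact: (integrable_box a b (cv i)).
rewrite big1// => i _.
have pvi : periodic (fun y => v y 0 i) ((b 0 i - a 0 i) *: delta_mx 0 i).
  by move=> x; rewrite pv.
have h := integral_box_partial (ab i) (dv i) (cv i) pvi.
(* [h] concerns only the [fine] part of the integral, and [fine] also sends infinite values to 0.
   Integrability excludes these, so the extended integral itself is zero. *)
rewrite -[LHS]fineK; first by congr EFin.
apply: integrable_fin_num; first exact: measurable_preimage_box.
exact: (integrable_box a b (cv i)).
Qed.

(** * Regularity and periodicity of the flux *)

(** Only a directional derivative of [p] is assumed, so the chain rule is applied to the restriction
    of [p] to the line through [x] along [v], where derivable and differentiable coincide. *)
Lemma derive_comp_real (R : realType) (V : normedModType R) (M : R -> R)
    (p : V -> R) (x v : V) : derivable p x v -> derivable M (p x) 1 ->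
  derivable (M \o p) x v /\ 'D_v (M \o p) x = 'D_1 M (p x) * 'D_v p x.
Proof.
move=> dp dM.
have E (f : V -> R) := derive_line f x v 0; rewrite scale0r add0r in E.
pose q (s : R) := p (s *: v + x).
have dq : derivable q 0 1 by apply/(E p).1.
have q0 : q 0 = p x by rewrite /q scale0r add0r.
have dMq : derivable M (q 0) 1 by rewrite q0.
split.
  apply/(E (M \o p)).1/derivable1_diffP.
  by apply: (@differentiable_comp _ _ _ _ q M); apply/derivable1_diffP.
rewrite -(E (M \o p)).2 -(E p).2 -!derive1E -q0.
exact: derive1_comp.
Qed.

(** The product and chain rules express the derivative through [M], its derivative, and derivatives
    of [p] up to order one and of [m] up to order two, all continuous. This supplies the smoothness
    required by [integral_box_divergence]. *)
Lemma partial_flux (R : realType) (d : nat) (M : R -> R) (p m : 'rV[R]_d -> R)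
    (i : 'I_d) : Ck 1 M -> Ck 1 p -> Ck 2 m ->
  (forall x, derivable (fun y => M (p y) * partial i m y) x (delta_mx 0 i)) /\
  continuous (partial i (fun y => M (p y) * partial i m y)).
Proof.
move=> [cM /(_ 1)[dM [cdM _]]] [cp /(_ (delta_mx 0 i))[dp [cdp _]]].
move=> [cm /(_ (delta_mx 0 i))[dm [cdm /(_ (delta_mx 0 i))[ddm [cddm _]]]]].
have dMp x := derive_comp_real (dp x) (dM (p x)).
have cMp : continuous (M \o p).
  by move=> x; apply: continuous_comp; [exact: cp|exact: cM].
split=> [x|]; first by apply: derivableM; [exact: (dMp x).1|exact: ddm].
rewrite (_ : partial i _ = fun x => M (p x) * partial i (partial i m) x
    + partial i m x * ('D_1 M (p x) * partial i p x)); last first.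
  apply/funext => x; rewrite {1}/partial (deriveM (dMp x).1 (ddm x)).
  by rewrite (dMp x).2.
move=> x; have cdMp := continuous_comp (cp x) (cdM (p x)).
exact: (cvgD (cvgM (cMp x) (cddm x)) (cvgM (cdm x) (cvgM cdMp (cdp x)))).
Qed.

(** The combination has the shape of [extrapolate], so the argument of the mobility is C^1. *)
Lemma Ck1_lincomb (R : realType) (d : nat) (f g : 'rV[R]_d -> R) (k l : R) :
  Ck 1 f -> Ck 1 g -> Ck 1 (fun x => k * f x - l * g x).
Proof.
move=> [cf df] [cg dg]; split.
  by move=> x; exact: (cvgB (cvgM (cvg_cst k) (cf x)) (cvgM (cvg_cst l) (cg x))).
move=> v; have [{}df [cdf _]] := df v; have [{}dg [cdg _]] := dg v.
have E x : is_derive x v (fun x => k * f x - l * g x) (k * 'D_v f x - l * 'D_v g x).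
  have ef := derivableP (df x); have eg := derivableP (dg x).
  exact: (is_deriveB (is_deriveZ k ef) (is_deriveZ l eg)).
split=> [x|]; first by case: (E x).
split=> //.
rewrite (_ : (fun x => _) = fun x => k * 'D_v f x - l * 'D_v g x); last first.
  by apply/funext => x; case: (E x).
by move=> x; exact: (cvgB (cvgM (cvg_cst k) (cdf x)) (cvgM (cvg_cst l) (cdg x))).
Qed.

(** The difference quotients at [x] and at its translate by [w] coincide. *)
Lemma periodic_derive (R : realType) (V : normedModType R) (f : V -> R) (v w : V) :
  periodic f w -> periodic ('D_v f) w.
Proof.
move=> pf x; rewrite /derive.
rewrite (_ : (fun h => _) = (fun h => h^-1 *: ((f \o shift x) (h *: v) - f x)))//.
by apply/funext => h /=; rewrite addrA !pf.
Qed.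

(** * Mass conservation for the scheme *)

Theorem theorem4p4 (R : realType) (d : nat) (d23 : d = 2%N \/ d = 3%N)
  (a b : 'rV[R]_d) (ab : forall i, a 0 i < b 0 i)
  (theta alpha beta eps lambda1 lambda2 lambda3 C0 : R)
  (theta_range : 2^-1 <= theta <= 1)
  (alpha_ge0 : 0 <= alpha) (beta_gt0 : 0 < beta) (eps_gt0 : 0 < eps)
  (lambda1_gt0 : 0 < lambda1) (lambda2_gt0 : 0 < lambda2)
  (lambda3_gt0 : 0 < lambda3) (C0_gt0 : 0 < C0)
  (M : R -> R) (M0 : R) (M0_gt0 : 0 < M0) (M_ge : forall s, M0 <= M s)
  (M_C1 : Ck 1 M)
  (V : R -> R) (V_C2 : Ck 2 V) (V_gt0 : forall s, 0 < V s) (V1 : V 1 = 1)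
  (V_lim : (V s - 1) / (1 - s) @[s --> (1 : R)^'] --> (1 : R))
  (N : nat) (T : R) (t : nat -> R) (t0 : t 0%N = 0) (tN : t N = T)
  (t_incr : forall n, (n < N)%N -> t n < t n.+1)
  (phi mu : nat -> 'rV[R]_d -> R) (u : nat -> R)
  (phi_periodic : forall n, (n <= N)%N -> box_periodic a b (phi n))
  (phi_C4 : forall n, (n <= N)%N -> Ck 4 (phi n))
  (mu_periodic : forall n, (0 < n < N)%N -> box_periodic a b (mu n))
  (mu_C2 : forall n, (0 < n < N)%N -> Ck 2 (mu n))
  (E2_gt0 : forall n, (n <= N)%N ->
     0 < E2 alpha beta eps lambda1 lambda2 lambda3 a b C0 (phi n))
  (scheme : forall n, (0 < n < N)%N ->
     let phistar x := extrapolate t theta (phi^~ x) n in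
     let phitheta x := average theta (phi^~ x) n in
     let Zstar := calZ alpha beta eps lambda1 lambda2 lambda3 phistar in
     let sqrtE := Num.sqrt (E2 alpha beta eps lambda1 lambda2 lambda3 a b C0 (phi n)) in
     let xi := u n.+1 / sqrtE in
     [/\ forall x, box a b x ->
           Dtheta t theta (phi^~ x) n =
           divergence (fun y => M (phistar y) *: grad (mu n) y) x,
         forall x, box a b x -> calZ_defined alpha phistar x ->
           mu n x = u n.+1 / sqrtE * V xi * Zstar x
                    + lambda1 / eps ^+ 2 * phitheta x
                    - lambda2 * laplacian phitheta x
                    + lambda3 * laplacian (laplacian phitheta) x &
         (u n.+1 - u n) / step t n.+1 =
           V xi / (2 * sqrtE)
           * integral_box a b
               (fun x => Zstar x * ((phi n.+1 x - phi n x) / step t n.+1))])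
  (mass01 : integral_box a b (phi 1%N) = integral_box a b (phi 0%N)) :
  forall n, (n < N)%N -> forall k, (k <= n)%N ->
    integral_box a b (phi n.+1) = integral_box a b (phi k).
Proof.
suff mass_step n : (n < N)%N -> integral_box a b (phi n.+1) = integral_box a b (phi n).
  elim=> [|n IH] nN k; first by rewrite leqn0 => /eqP ->; exact: mass_step.
  rewrite leq_eqVlt ltnS => /predU1P[->|kn]; first exact: mass_step.
  by rewrite mass_step// (IH (ltnW nN) k kn).
(* The scheme starts at index 1, so the first increment comes from the starting values; the equation
   at index [n.+1] then governs the increment from [n.+1] to [n.+2]. *)
elim: n => [_|n IH nN]; first exact: mass01.
have {}IH := IH (ltnW nN).
have nN' : (0 < n.+1 < N)%N by [].
have [pde _ _] := scheme n.+1 nN'.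
have n1N : (n.+1 <= N)%N by exact: ltnW.
have n0N : (n <= N)%N by exact: ltnW.
have cphi k : (k <= N)%N -> continuous (phi k) by move=> /phi_C4[].
have Ck1phi k : (k <= N)%N -> Ck 1 (phi k).
  move=> /phi_C4[ck dk]; split=> // v; have [dkv [cdk _]] := dk v.
  by split.
have flux i : (fun y => (M (extrapolate t theta (phi^~ y) n.+1) *: grad (mu n.+1) y) 0 i) =
    fun y => M (extrapolate t theta (phi^~ y) n.+1) * partial i (mu n.+1) y.
  by apply/funext => y; rewrite !mxE.
(* Unqualified, [ratio] is the type of fractions of MathComp. *)
have C1flux i := partial_flux i M_C1 (Ck1_lincomb (1 + theta * Defs.ratio t n.+2)
  (theta * Defs.ratio t n.+2) (Ck1phi _ n1N) (Ck1phi _ n0N)) (mu_C2 _ nN').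
have := eq_integral_box pde.
rewrite integral_box_divergence//; first last.
- move=> i x; congr (_ *: _).
    by rewrite /extrapolate !(phi_periodic _ _ i).
  by apply/rowP => j; rewrite !mxE; apply: periodic_derive; exact: mu_periodic.
- by move=> i; rewrite flux; have [] := C1flux i.
- by move=> i; rewrite flux; have [] := C1flux i.
rewrite /Dtheta /= => mass.
set c1 := _ / _ in mass; set c2 := _ / _ in mass.
have cd k l : (k <= N)%N -> (l <= N)%N -> continuous (fun x => phi k x - phi l x).
  by move=> kN lN x; exact: (cvgB (cphi k kN x) (cphi l lN x)).
have cZ c (f : 'rV[R]_d -> R) : continuous f -> continuous (fun x => c * f x).
  by move=> cf x; exact: (cvgM (cvg_cst c) (cf x)).
move: mass; rewrite integral_boxD; [|exact/cZ/cd|exact/cZ/cd].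
rewrite !integral_boxZ; [|exact: cd|exact: cd].
rewrite !integral_boxB; [|exact: cphi..].
(* The induction hypothesis cancels the older increment, leaving [c1] times the new one equal to
   zero. It remains to exclude [c1 = 0]: with positive steps and [theta] nonnegative, its numerator
   is at least 1 and its denominator is positive. *)
rewrite IH subrr mulr0 addr0 => /eqP; rewrite mulf_eq0 => /orP[/eqP c10|]; last first.
  by rewrite subr_eq0 => /eqP.
have s1 : 0 < step t n.+1 by rewrite /step subr_gt0 t_incr// (ltn_trans _ nN).
have s2 : 0 < step t n.+2 by rewrite /step subr_gt0 t_incr.
have r0 : 0 < Defs.ratio t n.+2 by rewrite /Defs.ratio divr_gt0.
have theta0 : 0 <= theta.
  by case/andP: theta_range => h _; apply: le_trans h; rewrite invr_ge0.
suff : 0 < c1 by rewrite c10 ltxx.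
rewrite /c1 divr_gt0//.
  by apply: ltr_pwDl => //; rewrite mulr_ge0 ?(ltW r0)// mulr_ge0.
by rewrite mulr_gt0// addr_gt0.
Qed.
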